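(* For a connected graph $G$ and $v\in V(G)$, we have $|EM(v)|=1$ if and only if $G=K_2$.
   Context: Graphs are finite, undirected and simple; $K_2$ is the complete graph on two vertices and equality of graphs is up to isomorphism. $d_G(x,y)$ is the distance between $x$ and $y$ in $G$, and $G-e$ is the graph obtained from $G$ by deleting the edge $e$ (distances between different components are $\infty$). For a vertex $x$ of $G$, $EM(x)$ is the set of edges $e\in E(G)$ such that there exists a vertex $y\in V(G)$ with $d_G(x,y)\neq d_{G-e}(x,y)$. *)

(* Defs.v *)
From mathcomp Require Import all_boot.
Set Implicit Arguments.
Unset Strict Implicit.
Unset Printing Implicit Defensive.

Record sgraph := SGraph {
  vertex :> finType;
  adj : rel vertex;
  adj_sym : symmetric adj;
  adj_irrefl : irreflexive adj }.

Definition edges (G : sgraph) : {set {set G}} :=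
  [set [set p.1; p.2] | p : G * G & adj p.1 p.2].

Definition connected (G : sgraph) : Prop :=
  forall x y : G, connect (@adj G) x y.

Definition isomorphic (G H : sgraph) : Prop :=
  exists2 f : G -> H, bijective f & forall x y : G, adj (f x) (f y) = adj x y.

Section Complete.
Variable n : nat.

Definition complete_adj : rel 'I_n := fun i j => i != j.

Lemma complete_adj_sym : symmetric complete_adj.
Proof. by move=> i j; rewrite /complete_adj eq_sym. Qed.

Lemma complete_adj_irrefl : irreflexive complete_adj.
Proof. by move=> i; rewrite /complete_adj eqxx. Qed.

Definition complete_graph := SGraph complete_adj_sym complete_adj_irrefl.
End Complete.

Section DeleteEdge.
Variables (G : sgraph) (e : {set G}).

Definition del_adj : rel G := fun x y => adj x y && ([set x; y] != e).

Lemma del_adj_sym : symmetric del_adj.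
Proof. by move=> x y; rewrite /del_adj adj_sym setUC. Qed.

Lemma del_adj_irrefl : irreflexive del_adj.
Proof. by move=> x; rewrite /del_adj adj_irrefl. Qed.

Definition del_edge := SGraph del_adj_sym del_adj_irrefl.
End DeleteEdge.

Section Distance.
Variables (G : sgraph) (x y : G).

Definition has_walk (n : nat) : bool :=
  [exists p : n.-tuple G, path (@adj G) x p && (last x p == y)].

Lemma connect_has_walk : connect (@adj G) x y -> exists n, has_walk n.
Proof.
move/connectP => [p Pp yE]; exists (size p).
by apply/existsP; exists (in_tuple p); rewrite Pp /= yE.
Qed.

(* [None] is the infinite distance between different components. *)
Definition dist : option nat :=
  if decP (@idP (connect (@adj G) x y)) is left xy
  then Some (ex_minn (connect_has_walk xy)) else None.

Lemma dist_SomeP n :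
  dist = Some n <-> has_walk n /\ forall m, has_walk m -> n <= m.
Proof.
rewrite /dist; case: (decP idP) => [xy | nxy]; last first.
  split=> // -[/existsP[p /andP[Pp /eqP lp]] _].
  by case: nxy; apply/connectP; exists p; rewrite ?lp.
case: ex_minnP => k wk kmin; split=> [[<-] //|[wn nmin]].
by congr Some; apply/eqP; rewrite eqn_leq kmin // nmin.
Qed.
End Distance.

Definition EM (G : sgraph) (x : G) : {set {set G}} :=
  [set e in edges G |
    [exists y : G, dist x y != @dist (del_edge e) x y]].

(* Main.v *)
Require Import Defs.
From mathcomp Require Import all_boot.

(** If an edge [uy] is the last step of every geodesic from [v] to [y], then
    it lies in [EM v]. Hence [EM v] contains every edge at [v]; if it has one
    element then [v] has a single neighbour [w], every geodesic from [v] to a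
    neighbour [u] of [w] other than [v] ends with [wu], and such a [u] would
    put a second edge into [EM v]. *)

Lemma has_walk0 (G : sgraph) (x y : G) : has_walk x y 0 = (x == y).
Proof.
apply/existsP/idP => [[p]|xy]; first by rewrite tuple0.
by exists [tuple].
Qed.

(** Peeling off the last step, whereas [path] recurses on the first, isolates the step into [y] that
    the deletion argument needs. *)
Lemma has_walkS (G : sgraph) (x y : G) n :
  has_walk x y n.+1 = [exists z, has_walk x z n && adj z y].
Proof.
apply/existsP/existsP => [[[p sp]] /= | [z /andP[/existsP[p /andP[Pp /eqP zE]] zy]]].
  case/lastP: p sp => // p z; rewrite size_rcons eqSS => sp.
  rewrite rcons_path last_rcons => /andP[/andP[Pp pz] /eqP <-].
  exists (last x p); rewrite pz andbT.
  by apply/existsP; exists (Tuple sp); rewrite Pp eqxx.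
by exists [tuple of rcons p y]; rewrite rcons_path last_rcons Pp zE zy eqxx.
Qed.

Lemma has_walk1 (G : sgraph) (x y : G) : has_walk x y 1 = adj x y.
Proof.
rewrite has_walkS; apply/existsP/idP => [[z]|xy]; first last.
  by exists x; rewrite has_walk0 eqxx.
by rewrite has_walk0 => /andP[/eqP ->].
Qed.

Lemma has_walk_del_edge (G : sgraph) (e : {set G}) (x y : G) n :
  @has_walk (del_edge e) x y n -> has_walk x y n.
Proof.
case/existsP=> p /andP[Pp lp]; apply/existsP; exists p; rewrite lp andbT.
by apply: sub_path Pp => a b /andP[].
Qed.

Lemma edges_adj {G : sgraph} {x y : G} : adj x y -> [set x; y] \in edges G.
Proof. by move=> xy; apply/imsetP; exists (x, y); rewrite ?inE. Qed.

(** Here [y] is at distance [n.+1] from [v]. A walk of that length avoiding the edge [uy] is also a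
    walk of [G], so its penultimate vertex is [u] and its last step is the deleted edge after
    all. *)
Lemma EM_last_step (G : sgraph) (v u y : G) n :
    has_walk v u n -> adj u y ->
    (forall m, m <= n -> ~~ has_walk v y m) ->
    (forall z, has_walk v z n -> adj z y -> z = u) ->
  [set u; y] \in EM v.
Proof.
move=> vu uy vy_min u_uniq; rewrite inE edges_adj //=.
apply/existsP; exists y; apply/eqP => dE.
have dy : dist v y = Some n.+1.
  apply/dist_SomeP; split=> [|m vy].
    by rewrite has_walkS; apply/existsP; exists u; rewrite vu.
  by rewrite ltnNge; apply: contraL vy => /vy_min.
move: dy; rewrite dE => /dist_SomeP[]; rewrite has_walkS => /existsP[z].
case/andP=> /has_walk_del_edge vz /andP[zy]; rewrite (u_uniq z) //.
by rewrite eqxx.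
Qed.

Lemma adj_neq {G : sgraph} {x y : G} : adj x y -> x != y.
Proof. by apply: contraTneq => ->; rewrite adj_irrefl. Qed.

Lemma EM_incident {G : sgraph} {v w : G} : adj v w -> [set v; w] \in EM v.
Proof.
move=> vw; apply: (@EM_last_step _ _ _ _ 0) => // [|[|//] _|z].
- by rewrite has_walk0.
- by rewrite has_walk0 adj_neq.
- by rewrite has_walk0 => /eqP.
Qed.

(** A common edge of [v] and [u] would force [u = w], so [u] is at distance 2 from [v], and [w] is
    the only possible midpoint. *)
Lemma EM_pendant {G : sgraph} {v w u : G} :
    adj v w -> (forall z, adj v z -> z = w) -> adj w u -> u != v ->
  [set w; u] \in EM v.
Proof.
move=> vw w_uniq wu uv; apply: (@EM_last_step _ _ _ _ 1) => //.
- by rewrite has_walk1.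
- move=> [|[|//]] _; first by rewrite has_walk0 eq_sym.
  by rewrite has_walk1; apply/negP => /w_uniq uw; rewrite uw adj_irrefl in wu.
- by move=> z; rewrite has_walk1 => /w_uniq.
Qed.

Lemma connected_closed_full (G : sgraph) (A : {set G}) (x : G) :
    connected G -> x \in A -> (forall a b, a \in A -> adj a b -> b \in A) ->
  A = setT.
Proof.
move=> Gconn xA Aadj; apply/setP => y; rewrite inE.
have /connectP[p + ->] := Gconn x y.
elim: p x xA => //= z p IHp x xA /andP[xz]; apply: IHp; exact: Aadj xz.
Qed.

Lemma isomorphic_K2 {G : sgraph} {v w : G} :
  adj v w -> [set v; w] = setT -> isomorphic G (complete_graph 2).
Proof.
move=> vw GE; have nvw := adj_neq vw.
have vwP x : x = v \/ x = w.
  by have: x \in [set v; w]; rewrite GE // -GE => /set2P.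
pose f (x : G) : complete_graph 2 := if x == v then ord0 else ord_max.
have fv : f v = ord0 by rewrite /f eqxx.
have fw : f w = ord_max by rewrite /f eq_sym (negbTE nvw).
exists f.
  apply: inj_card_bij; last by rewrite card_ord -cardsT -GE cards2 nvw.
  by move=> x y; case: (vwP x) (vwP y) => -> [] -> //; rewrite fv fw.
move=> x y; case: (vwP x) (vwP y) => -> [] ->; rewrite ?fv ?fw ?adj_irrefl //.
by rewrite [RHS]adj_sym vw.
Qed.

Lemma edges_card2 (G : sgraph) (e : {set G}) : e \in edges G -> #|e| = 2.
Proof. by case/imsetP=> -[x y]; rewrite inE /= => xy ->; rewrite cards2 adj_neq. Qed.

Theorem theorem4p10 (G : sgraph) (v : G) (Gconn : connected G) :
  #|EM v| = 1 <-> isomorphic G (complete_graph 2).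
Proof.
split=> [/eqP/cards1P[e EMv] | [f fbij fadj]].
  have [w vw|v_iso] := pickP (adj v); last first.
    (* An isolated [v] is a whole connected component, so [G] is too small to contain the two ends
       of [e]. *)
    have GE : [set v] = setT.
      apply: connected_closed_full Gconn (set11 v) _ => a b /set1P->.
      by rewrite v_iso.
    have : e \in EM v by rewrite EMv set11.
    rewrite inE => /andP[/edges_card2 e2 _].
    by have := subset_leq_card (subsetT e); rewrite -GE cards1 e2.
  have EM_eq e' : e' \in EM v -> e' = [set v; w].
    by move: (EM_incident vw); rewrite EMv => /set1P-> /set1P.
  have w_uniq z : adj v z -> z = w.
    move=> vz; have: z \in [set v; w] by rewrite -(EM_eq _ (EM_incident vz)) set22.
    by case/set2P=> // zv; rewrite zv adj_irrefl in vz.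
  (* It remains to see that no edge leaves [[set v; w]]; an edge from [w] to some [b] other than [v]
     would be a second element of [EM v]. *)
  apply: (isomorphic_K2 vw); apply: connected_closed_full Gconn (set21 v w) _.
  move=> a b /set2P[] -> => [/w_uniq ->|wb]; first exact: set22.
  have [-> | bv] := eqVneq b v; first exact: set21.
  by rewrite -(EM_eq _ (EM_pendant vw w_uniq wb bv)) set22.
have G2 : #|[set: G]| = 2 by rewrite cardsT (bij_eq_card fbij) card_ord.
(* With only two vertices, the full vertex set is the only candidate for an edge. *)
have edgeT e : e \in edges G -> e = setT.
  by move/edges_card2=> e2; apply/eqP; rewrite eqEcard subsetT e2 G2.
have [g _ gK] := fbij.
(* [rev_ord] swaps the two elements of ['I_2], so its value at [f v] is the other vertex of the
   complete graph, and [g] pulls it back to a neighbour of [v]. *)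
have vw : adj v (g (rev_ord (f v))).
  by rewrite -fadj gK; case: (f v) => -[|[|]].
apply/eqP/cards1P; exists setT; apply/setP => e; rewrite inE.
apply/idP/eqP => [|->]; first by rewrite inE => /andP[/edgeT].
by rewrite -(edgeT _ (edges_adj vw)) EM_incident.
Qed.
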